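(* Let $d\ge 1$ be an integer, and let $\mu$ be a probability measure on $(\mathbb{R}^d,\mathcal{B}^d)$ with characteristic function $\chi$. If $\chi\in L^1(\lambda^d)$, then $\mu$ is absolutely continuous with respect to $\lambda^d$, and a probability density function for $\mu$ (with respect to $\lambda^d$) is given by \[g(z)=\frac{1}{(2\pi)^d}\int_{\mathbb{R}^d}\chi(y)\exp\bigl(-i\langle z,y\rangle\bigr)\,d\lambda^d(y),\quad z\in\mathbb{R}^d.\]
   Context: $\mathcal{B}^d$ denotes the Borel $\sigma$-field of $\mathbb{R}^d$, $\lambda^d$ denotes $d$-dimensional Lebesgue measure, and $\langle\cdot,\cdot\rangle$ denotes the standard Euclidean inner product on $\mathbb{R}^d$. The characteristic function of $\mu$ is the function $\chi:\mathbb{R}^d\to\mathbb{C}$, $\chi(t)=\int_{\mathbb{R}^d}\exp(i\langle t,x\rangle)\,d\mu(x)$. *)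

(* Defs.v *)
From HB Require Import structures.
From mathcomp Require Import all_boot all_order all_algebra.
From mathcomp Require Import all_classical all_reals all_analysis.
From mathcomp Require Import measurable_realfun complex.

Set Implicit Arguments.
Unset Strict Implicit.
Unset Printing Implicit Defensive.

Import Order.TTheory GRing.Theory Num.Theory.
Import numFieldNormedType.Exports.

Local Open Scope classical_set_scope.
Local Open Scope complex_scope.
Local Open Scope ring_scope.

Notation borel_rV R d := (g_sigma_algebraType (@open 'rV[R]_d)).

(** [rV_cons (t, x)] is the row vector (t, x_0, ..., x_{n-1}). *)
Definition rV_cons (R : realType) (n : nat)
    (p : measurableTypeR R * borel_rV R n) : borel_rV R n.+1 :=
  row_mx (p.1%:M : 'rV[R]_1) (p.2 : 'rV[R]_n).

Section rV_cons_theory.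
Variable R : realType.

Lemma rV_consE0 n p : (@rV_cons R n p : 'rV[R]_n.+1) ord0 ord0 = p.1.
Proof.
rewrite /rV_cons; have -> : @ord0 n = lshift n (@ord0 0) by exact: val_inj.
by apply: (etrans (row_mxEl _ _ _ _)); rewrite mxE eqxx.
Qed.

Lemma rV_consES n p (i : 'I_n) :
  (@rV_cons R n p : 'rV[R]_n.+1) ord0 (lift ord0 i) = (p.2 : 'rV[R]_n) ord0 i.
Proof.
rewrite /rV_cons; have -> : lift ord0 i = rshift 1 i by exact: val_inj.
exact: row_mxEr.
Qed.

Lemma open_rV_boxes n (U : set 'rV[R]_n) : open U ->
  U = \bigcup_(qk : 'rV[rat]_n * nat)
    [set x | ball (map_mx ratr qk.1 : 'rV[R]_n) qk.2.+1%:R^-1 `<=` U /\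
             ball (map_mx ratr qk.1 : 'rV[R]_n) qk.2.+1%:R^-1 x].
Proof.
move=> oU; apply/seteqP; split; last by move=> x [qk /= _ [+ qkx]]; exact.
move=> x Ux.
move: oU; rewrite openE => /(_ _ Ux)/nbhs_ballP[e /= e0 eU].
have [k ke] : exists k : nat, k.+1%:R^-1 < e / 2.
  have e20 : 0 < e / 2 by rewrite divr_gt0.
  exists (Num.truncn (e / 2)^-1).
  by rewrite -[ltRHS]invrK ltf_pV2 ?posrE ?invr_gt0// truncnS_gt.
have r0 : 0 < k.+1%:R^-1 :> R by rewrite invr_gt0.
have /choice[f fP] : forall i : 'I_n, exists q : rat,
    `|x ord0 i - ratr q| < k.+1%:R^-1.
  move=> i.
  have [q /itvP qP] := @rat_in_itvoo R (x ord0 i) (x ord0 i + k.+1%:R^-1)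
    ltac:(by rewrite ltrDl).
  exists q; rewrite distrC ger0_norm ?subr_ge0 ?qP//.
  by rewrite ltrBlDl qP.
exists (\row_i f i, k) => //=; split.
  move=> y [_ yP]; apply: eU; split => // i j.
  have := yP i j; rewrite !mxE /ball/= => H.
  rewrite (ord1 i) in H *.
  rewrite -(subrK (ratr (f j)) (x ord0 j)) -addrA.
  apply: (le_lt_trans (ler_normD _ _)).
  rewrite (splitr e) ltrD//.
    exact: (lt_trans (fP j)).
  exact: (lt_trans H).
split => // i j; rewrite !mxE /ball/= distrC (ord1 i); exact: fP.
Qed.

Lemma measurable_rV_cons n : measurable_fun [set: _] (@rV_cons R n).
Proof.
have mbox m (q : 'rV[rat]_m) k :
    measurable (ball (map_mx ratr q : 'rV[R]_m) k.+1%:R^-1 : set (borel_rV R m)).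
  by apply: sub_sigma_algebra; apply: ball_open; rewrite invr_gt0.
apply: (@measurability _ _ (measurableTypeR R * borel_rV R n)%type
  (borel_rV R n.+1) setT (@rV_cons R n) (@open 'rV[R]_n.+1)) => //.
move=> _ [U oU <-]; rewrite setTI (open_rV_boxes oU) preimage_bigcup.
apply: countable_bigcupT_measurable.
  exact: countableP.
move=> [q k] /=.
have [sU|nU] := pselect (ball (map_mx ratr q : 'rV[R]_n.+1) k.+1%:R^-1 `<=` U);
  last first.
  rewrite (_ : _ @^-1` _ = set0); first exact: measurable0.
  by rewrite -subset0 => p [].
rewrite (_ : _ @^-1` _ = ball (ratr (q ord0 ord0) : R) k.+1%:R^-1 `*`
    ball (map_mx ratr (\row_i q ord0 (lift ord0 i)) : 'rV[R]_n) k.+1%:R^-1).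
  apply: measurableX; last exact: mbox.
  by apply: open_measurable; apply: ball_open; rewrite invr_gt0.
apply/seteqP; split => [p [_ [r0 pP]]|p [p0 [r0 pP]]].
  split; first by have := pP ord0 ord0; rewrite rV_consE0 !mxE.
  by split => // i j; rewrite (ord1 i); have := pP ord0 (lift ord0 j);
    rewrite rV_consES !mxE.
split => //; split => // i j; rewrite (ord1 i).
case: (unliftP ord0 j) => [j' ->|->]; last by rewrite rV_consE0 mxE.
by have := pP ord0 j'; rewrite rV_consES !mxE.
Qed.

End rV_cons_theory.

Section lebesgue_cons.
Variables (R : realType) (n : nat).

Let uncons (x : borel_rV R n.+1) : measurableTypeR R * borel_rV R n :=
  ((x : 'rV[R]_n.+1) ord0 ord0, rsubmx (x : 'rV[R]_(1 + n))).

Let consK : cancel (@rV_cons R n) uncons.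
Proof.
move=> [t x]; congr (_, _); first exact: rV_consE0.
exact: row_mxKr.
Qed.

Let measurable_uncons : measurable_fun setT uncons.
Proof.
apply/measurable_fun_pairP; split.
  apply: (measurability _ (RGenOpens.measurableE R)).
  move=> _ [_ [a [b ->]] <-]; rewrite setTI.
  apply: sub_sigma_algebra; apply: open_comp; last exact: itv_open.
  by move=> x _; exact: coord_continuous.
apply: (@measurability _ _ (borel_rV R n.+1) (borel_rV R n) setT _
  (@open 'rV[R]_n)) => //.
move=> _ [U oU <-]; rewrite setTI.
apply: sub_sigma_algebra; apply: open_comp => // x _.
exact: continuous_rsubmx.
Qed.

Variable mu : {sigma_finite_measure set (borel_rV R n) -> \bar R}.

Definition lebesgue_cons : set (borel_rV R n.+1) -> \bar R :=
  pushforward (lebesgue_measure \x mu)%E (@rV_cons R n).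

Let lebesgue_cons0 : lebesgue_cons set0 = 0%E.
Proof. by rewrite /lebesgue_cons /pushforward preimage_set0 measure0. Qed.

Let lebesgue_cons_ge0 A : (0 <= lebesgue_cons A)%E.
Proof. by have mf := @measurable_rV_cons R n; exact: measure_ge0. Qed.

Let lebesgue_cons_sigma_additive : semi_sigma_additive lebesgue_cons.
Proof.
by have mf := @measurable_rV_cons R n; exact: measure_semi_sigma_additive.
Qed.

HB.instance Definition _ := isMeasure.Build _ _ _ lebesgue_cons
  lebesgue_cons0 lebesgue_cons_ge0 lebesgue_cons_sigma_additive.

Let lebesgue_cons_sigma_finite : sigma_finite setT lebesgue_cons.
Proof.
have /sigma_finiteP[F [TF ndF Foo]] := sigma_finiteT (@lebesgue_measure R).
have /sigma_finiteP[G [TG ndG Goo]] := sigma_finiteT mu.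
exists (fun i => uncons @^-1` (F i `*` G i)).
  rewrite -preimage_bigcup (_ : \bigcup_i _ = setT) ?preimage_setT//.
  apply/seteqP; split => // -[x y] _.
  have [i _ Fx] : (\bigcup_i F i) x by rewrite -TF.
  have [j _ Gy] : (\bigcup_i G i) y by rewrite -TG.
  exists (maxn i j) => //; split => /=.
  - by move: x Fx; exact/subsetPset/ndF/leq_maxl.
  - by move: y Gy; exact/subsetPset/ndG/leq_maxr.
move=> i; have [mF Fi] := Foo i; have [mG Gi] := Goo i; split.
  rewrite -[X in measurable X]setTI; apply: measurable_uncons => //.
  exact: measurableX.
rewrite /lebesgue_cons /pushforward (_ : _ @^-1` _ = F i `*` G i).
  by rewrite product_measure1E// lte_mul_pinfty// ge0_fin_numE.
rewrite -comp_preimage (_ : uncons \o _ = id)//.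
by apply/funext => p; exact: consK.
Qed.

HB.instance Definition _ := Measure_isSigmaFinite.Build _ _ _ lebesgue_cons
  lebesgue_cons_sigma_finite.

End lebesgue_cons.

(** Lebesgue measure on R^d as the d-fold product of Lebesgue measure on R. *)
Fixpoint lebesgue_measure_rV (R : realType) (d : nat) :
    {sigma_finite_measure set (borel_rV R d) -> \bar R} :=
  match d with
  | 0 => \d_(0 : borel_rV R 0)
  | n.+1 => lebesgue_cons (lebesgue_measure_rV R n)
  end.

Lemma measurable_rV_box (R : realType) (d : nat) (a b : 'rV[R]_d) :
  measurable ([set x : 'rV[R]_d | forall i,
    a ord0 i <= x ord0 i <= b ord0 i] : set (borel_rV R d)).
Proof.
rewrite -[X in measurable X]setCK; apply: measurableC.
apply: sub_sigma_algebra; apply: closed_openC.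
rewrite (_ : mkset _ = \bigcap_i
    [set x : 'rV[R]_d | x ord0 i \in `[a ord0 i, b ord0 i]]); last first.
  apply/seteqP; split => x /=.
    by move=> xP i _; rewrite /= in_itv /= xP.
  by move=> xP i; have := xP i I; rewrite /= in_itv.
apply: closed_bigI => i _.
apply: (@preimage_closed _ _ (fun x : 'rV[R]_d => x ord0 i)
  [set` `[a ord0 i, b ord0 i]]); last exact: itv_closed.
by move=> x _; exact: coord_continuous.
Qed.

Lemma lebesgue_measure_rV_box (R : realType) (d : nat) (a b : 'rV[R]_d) :
  (forall i, a ord0 i <= b ord0 i) ->
  lebesgue_measure_rV R d
    [set x : 'rV[R]_d | forall i, a ord0 i <= x ord0 i <= b ord0 i] =
  (\prod_i (b ord0 i - a ord0 i))%:E.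
Proof.
elim: d a b => [|n IH] a b ab.
  by rewrite big_ord0 /= diracE mem_set// => -[].
rewrite big_ord_recl EFinM /= /lebesgue_cons /pushforward.
rewrite (_ : _ @^-1` _ = `[a ord0 ord0, b ord0 ord0] `*`
  [set x : 'rV[R]_n | forall i,
    (\row_j a ord0 (lift ord0 j)) ord0 i <= x ord0 i
      <= (\row_j b ord0 (lift ord0 j)) ord0 i]); last first.
  apply/seteqP; split => p /=.
    move=> pP; split.
      by have := pP ord0; rewrite rV_consE0 /= in_itv.
    by move=> i; have := pP (lift ord0 i); rewrite rV_consES !mxE.
  move=> [p0 pP] i; case: (unliftP ord0 i) => [j ->|->].
    by have := pP j; rewrite rV_consES !mxE.
  by move: p0; rewrite rV_consE0 /= in_itv.
rewrite product_measure1E//; last exact: measurable_rV_box.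
rewrite IH; last by move=> i; rewrite !mxE; exact: ab.
congr (_ * _)%E; last by congr (_%:E); apply: eq_bigr => i _; rewrite !mxE.
apply: (etrans (lebesgue_measure_itv _)); rewrite /= lte_fin.
case: ltP => // ba; congr (_%:E).
by apply/esym/eqP; rewrite subr_eq0 eq_le ba ab.
Qed.

Definition dotv (R : realType) (d : nat) (x y : 'rV[R]_d) : R :=
  \sum_(i < d) x ord0 i * y ord0 i.

(** The complex exponential, e^(a + ib) = e^a (cos b + i sin b). *)
Definition cexp (R : realType) (z : R[i]) : R[i] :=
  (expR (complex.Re z) * cos (complex.Im z)) +i*
  (expR (complex.Re z) * sin (complex.Im z)).

(** [Normc.normc] is the modulus, valued in [R]. *)
Definition cintegrable (R : realType) (disp : measure_display)
    (T : measurableType disp) (mu : {measure set T -> \bar R})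
    (f : T -> R[i]) : Prop :=
  [/\ measurable_fun [set: T] (fun x => complex.Re (f x)),
      measurable_fun [set: T] (fun x => complex.Im (f x))
    & (\int[mu]_x (Normc.normc (f x))%:E < +oo)%E].

(** Meaningful only when [f] satisfies [cintegrable mu]. *)
Definition cintegral (R : realType) (disp : measure_display)
    (T : measurableType disp) (mu : {measure set T -> \bar R})
    (f : T -> R[i]) : R[i] :=
  (\int[mu]_x complex.Re (f x)) +i* (\int[mu]_x complex.Im (f x)).

Definition char_fun (R : realType) (d : nat) (mu : probability (borel_rV R d) R)
    (t : 'rV[R]_d) : R[i] :=
  cintegral mu (fun x : borel_rV R d => cexp ('i%C * (dotv t x)%:C)).

Definition is_pdf (R : realType) (disp : measure_display)
    (T : measurableType disp) (mu nu : {measure set T -> \bar R})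
    (f : T -> R) : Prop :=
  [/\ measurable_fun [set: T] f,
      forall x, 0 <= f x
    & forall A, measurable A -> mu A = (\int[nu]_(x in A) (f x)%:E)%E].

(* Main.v *)
From HB Require Import structures.
Require Import Defs.
From mathcomp Require Import all_boot all_order all_algebra.
From mathcomp Require Import all_classical all_reals all_analysis.
From mathcomp Require Import measurable_realfun complex ring lra.

Set Implicit Arguments.
Unset Strict Implicit.
Unset Printing Implicit Defensive.

Import Order.TTheory GRing.Theory Num.Theory.
Import numFieldNormedType.Exports.

Local Open Scope classical_set_scope.
Local Open Scope complex_scope.
Local Open Scope ring_scope.

(** Fourier inversion by Abel summation. Writing [chi] for the characteristic
    function, damp the inversion integral by [exp (- e * \sum_i |y_i|)]. The
    damped integrand is absolutely integrable against [lambda x mu], so Fubini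
    turns its integral at [z] into the integral over [x] with respect to [mu] of
    the transform of the damping factor at [x - z], and that transform is the
    product of Cauchy kernels [2 e / (e^2 + (x_i - z_i)^2)]
    ([integral_damp_cos], [integral_damp_phased]). The damped integral is thus
    a nonnegative real number; letting [e] tend to 0, dominated convergence
    (with dominating function [|chi|]) shows that the inversion integral itself
    is real and nonnegative at every point ([inversion_ge0], [inversion_pihalf]).

    To recognise it as a density, integrate the damped integrals over a box.
    Tonelli reduces this to integrating the Cauchy kernels over intervals, which
    gives differences of arctangents ([integral_box_cauchy]). As [e] tends to 0
    each such difference tends to [pi] if the point is inside the interval and
    to 0 if it is outside. At an endpoint the limit would be [pi / 2]; to get
    exactly the indicator of a closed box, the box is enlarged by [w] on every
    side while [e = w^2], so that endpoints are seen from a distance [w] that is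
    large compared to [e] ([cvg_atan_width]). Hence [(2 pi)^d mu(B)] is the
    integral of the inversion integral over [B] for every closed box [B]
    ([inversion_box]), and closed boxes form a generating pi-system.

    Complex values are avoided throughout by carrying a phase [t]: all integrals
    are those of [cos (<u, y> + t)], with [t = 0] giving real parts and
    [t = - pi / 2] imaginary parts. The phase also makes the passage from
    dimension [n] to [n + 1] a single application of Fubini, since the
    contribution of one coordinate is absorbed in the phase of the others. *)

(** * The damped cosine on the line *)

(** Folding the line onto a half-line cancels the odd part of an integrand; in
    [integral_expRN_normr_cos] this is what removes the sine. *)
Lemma ge0_integral_fold (R : realType) (f : R -> R) :
  (forall x, 0 <= f x) -> continuous f ->
  (\int[@lebesgue_measure R]_x (f x)%:E =
   \int[@lebesgue_measure R]_(x in `[(0%R:R), +oo[) (f x + f (- x))%:E)%E.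
Proof.
move=> f0 cf.
have mf : measurable_fun [set: R] f by exact: continuous_measurable_fun.
have cfN : continuous (fun x => f (- x)).
  by move=> x; apply: continuous_comp; [exact: oppr_continuous|exact: cf].
have mfN : measurable_fun [set: R] (fun x => f (- x)).
  exact: continuous_measurable_fun.
under [RHS]eq_integral do rewrite EFinD.
rewrite (@ge0_integralD _ _ _ (@lebesgue_measure R))//=; last 4 first.
- by move=> x _; rewrite lee_fin.
- by apply/measurable_EFinP; exact: measurable_funTS.
- by move=> x _; rewrite lee_fin.
- by apply/measurable_EFinP; exact: measurable_funTS.
rewrite -{1}(setUv (`[0%R, +oo[%classic : set R)).
rewrite ge0_integral_setU//=; last 4 first.
- exact: measurableC.
- by apply/measurable_EFinP; rewrite setUv.
- by move=> x _; rewrite lee_fin.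
- exact/disj_setPCl.
congr (_ + _)%E.
rewrite setCitvr integral_itv_bndo_bndc; last first.
  exact/measurable_EFinP/measurable_funTS.
rewrite -{1}oppr0 ge0_integration_by_substitutionNy//.
exact: continuous_subspaceT.
Qed.

Section damped.
Variables (R : realType) (e : R).
Hypothesis e0 : 0 < e.

(* An antiderivative of exp (- e y) (1 + a cos (u y)) that vanishes at +oo. *)
Let prim (u a y : R) : R := expR (- (e * y)) *
   (a * ((u * sin (u * y) - e * cos (u * y)) / (e ^+ 2 + u ^+ 2)) - e^-1).

Let den u : e ^+ 2 + u ^+ 2 != 0.
Proof. by rewrite gt_eqF// ltr_wpDr ?sqr_ge0// exprn_gt0. Qed.

Let dprim (u a y : R) : is_derive y (1:R) (prim u a)
  (expR (- (e * y)) * (1 + a * cos (u * y))).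
Proof.
rewrite /prim.
apply: is_derive_eq.
rewrite /GRing.scale/= ?(mulr1, mul1r, mulr0, addr0, subr0).
have := den u; have : e != 0 by rewrite gt_eqF.
by move=> ? ?; field; exact/andP.
Qed.

Let prim_y (u a : R) : prim u a y @[y --> +oo] --> 0.
Proof.
apply/cvgr0Pnorm_le.
pose K := `|a| * ((`|u| + e) / (e ^+ 2 + u ^+ 2)) + e^-1.
have K0 : 0 < K.
  by rewrite ltr_wpDl ?invr_gt0// mulr_ge0// divr_ge0 ?addr_ge0 ?sqr_ge0 ?(ltW e0).
have cvge : expR (- (e * y)) @[y --> +oo] --> (0:R).
  apply: (@cvg_comp _ _ _ (fun y => e * y) (fun y => expR (- y)) _ (pinfty_nbhs R)).
    exact: gt0_cvgMry.
  exact: cvgr_expR.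
move=> d d0; near=> y.
rewrite /prim normrM (ger0_norm (expR_ge0 _)).
apply: (@le_trans _ _ (d / K * K)); last by rewrite divfK// gt_eqF.
apply: ler_pM => //.
- rewrite -[leLHS]ger0_norm ?expR_ge0//; near: y.
  by move/cvgr0_norm_le : cvge; apply; rewrite divr_gt0.
- rewrite (le_trans (ler_normB _ _))// normrM normrM lerD//; last first.
    by rewrite ger0_norm// invr_ge0 ltW.
  rewrite ler_wpM2l// normfV (ger0_norm (_ : 0 <= e ^+ 2 + _)); last first.
    by rewrite addr_ge0// sqr_ge0.
  rewrite ler_wpM2r ?invr_ge0 ?addr_ge0 ?sqr_ge0//.
  rewrite (le_trans (ler_normB _ _))// lerD// normrM.
    by rewrite ler_piMr// ler_norml sin_geN1 sin_le1.
  by rewrite (ger0_norm (ltW e0)) ler_piMr ?(ltW e0)// ler_norml cos_geN1 cos_le1.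
Unshelve. all: by end_near. Qed.

Let cdamped (u a : R) :
  continuous (fun y : R => expR (- (e * y)) * (1 + a * cos (u * y))).
Proof.
move=> y; apply: cvgM.
  apply: continuous_comp; last exact: continuous_expR.
  by apply: cvgN; apply: cvgM; [exact: cvg_cst|exact: cvg_id].
apply: cvgD; first exact: cvg_cst.
apply: cvgM; first exact: cvg_cst.
apply: continuous_comp; last exact: continuous_cos.
by apply: cvgM; [exact: cvg_cst|exact: cvg_id].
Qed.

(* With |a| <= 1 the integrand is nonnegative, as the fundamental theorem of
   calculus on a half-line requires; this is why 1 is added to the cosine. *)
Let integral0y_damped (u a : R) : -1 <= a <= 1 ->
  (\int[@lebesgue_measure R]_(y in `[0%R:R, +oo[)
     (expR (- (e * y)) * (1 + a * cos (u * y)))%:E =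
   (e^-1 + a * (e / (e ^+ 2 + u ^+ 2)))%:E)%E.
Proof.
move=> /andP[a1 a2].
have cprim (y : R) : {for y, continuous (prim u a)}.
  by apply/differentiable_continuous/derivable1_diffP; case: (dprim u a y).
rewrite (@ge0_continuous_FTC2y _ _ (prim u a) _ 0)//.
- rewrite /prim !mulr0 oppr0 expR0 sin0 cos0 mulr0 !mulr1 mul1r sub0r -EFinB.
  by congr (_%:E); ring.
- move=> y y0; rewrite mulr_ge0 ?expR_ge0//.
  have : `|a * cos (u * y)| <= 1.
    rewrite normrM mulr_ile1// ler_norml; first by rewrite a1 a2.
    by rewrite cos_geN1 cos_le1.
  by rewrite ler_norml => /andP[+ _]; lra.
- apply: continuous_subspaceT; exact: cdamped.
- by apply: cvg_at_right_filter; exact: cprim.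
- by move=> x _; rewrite derive1E (@derive_val _ _ _ _ _ _ _ (dprim u a x)).
Qed.

Lemma continuous_expRN_normr : continuous (fun y : R => expR (- (e * `|y|))).
Proof.
move=> y; apply: continuous_comp; last exact: continuous_expR.
apply: cvgN; apply: cvgM; first exact: cvg_cst.
by apply: cvg_norm; exact: cvg_id.
Qed.

Lemma integral_expRN_normr :
  (\int[@lebesgue_measure R]_y (expR (- (e * `|y|)))%:E = (2 / e)%:E)%E.
Proof.
rewrite ge0_integral_fold//; last exact: continuous_expRN_normr.
rewrite (_ : 2 / e = e^-1 + 1 * (e / (e ^+ 2 + 0 ^+ 2))); last first.
  by field; rewrite gt_eqF.
rewrite -integral0y_damped ?lexx ?andbT; last lra.
apply: eq_integral => y; rewrite inE/= in_itv/= andbT => y0.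
by rewrite normrN ger0_norm// mul0r cos0 mulr1 mulrDr mulr1.
Qed.

Lemma integrable_expRN_normr :
  (@lebesgue_measure R).-integrable setT (fun y : R => (expR (- (e * `|y|)))%:E).
Proof.
apply/integrableP; split.
  apply/measurable_EFinP; apply: continuous_measurable_fun.
  exact: continuous_expRN_normr.
under eq_integral do rewrite gee0_abs ?lee_fin ?expR_ge0//.
by rewrite integral_expRN_normr ltry.
Qed.

(** [cos (u y + t) + cos (- u y + t) = 2 cos t cos (u y)], so folding the line
    leaves [cos t] times the transform of a symmetric function. *)
Lemma integral_expRN_normr_cos (u t : R) :
  (\int[@lebesgue_measure R]_y (expR (- (e * `|y|)) * cos (u * y + t))%:E =
   (cos t * (2 * e / (e ^+ 2 + u ^+ 2)))%:E)%E.
Proof.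
pose h y := expR (- (e * `|y|)) * (1 + cos (u * y + t)).
have ch : continuous h.
  move=> y; apply: cvgM; first exact: continuous_expRN_normr.
  apply: cvgD; first exact: cvg_cst.
  apply: continuous_comp; last exact: continuous_cos.
  by apply: cvgD; [apply: cvgM; [exact: cvg_cst|exact: cvg_id]|exact: cvg_cst].
have h0 y : 0 <= h y.
  by rewrite mulr_ge0 ?expR_ge0//; have := cos_geN1 (u * y + t); lra.
have inth : (\int[@lebesgue_measure R]_y (h y)%:E =
    (2 * (e^-1 + cos t * (e / (e ^+ 2 + u ^+ 2))))%:E)%E.
  rewrite ge0_integral_fold// EFinM -integral0y_damped; last first.
    by rewrite cos_geN1 cos_le1.
  rewrite -ge0_integralZl//=; last first.
    apply/measurable_EFinP; apply: measurable_funTS.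
    by apply: continuous_measurable_fun; exact: cdamped.
  apply: eq_integral => y; rewrite inE/= in_itv/= andbT => y0.
  rewrite /h normrN (ger0_norm y0) mulrN cosD.
  rewrite (_ : cos (- _ + t) = cos (- (u * y - t))); last by congr cos; ring.
  by rewrite cosN cosB -EFinM; congr EFin; ring.
have ih : (@lebesgue_measure R).-integrable setT (EFin \o h).
  apply/integrableP; split.
    by apply/measurable_EFinP; exact: continuous_measurable_fun.
  under eq_integral do rewrite gee0_abs ?lee_fin//.
  by rewrite inth ltry.
transitivity (\int[@lebesgue_measure R]_y ((h y)%:E - (expR (- (e * `|y|)))%:E))%E.
  by apply: eq_integral => y _; rewrite -EFinB; congr EFin; rewrite /h; ring.
rewrite integralB_EFin//; last exact: integrable_expRN_normr.
rewrite inth integral_expRN_normr -EFinB; congr EFin.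
by field; rewrite den gt_eqF.
Qed.

End damped.

(** * Measurability and iterated integrals on row vectors *)

Section measurability.
Variable R : realType.

Lemma measurable_coord n (i : 'I_n) :
  measurable_fun [set: borel_rV R n] (fun x : 'rV[R]_n => x ord0 i).
Proof.
apply: (measurability _ (RGenOpens.measurableE R)).
move=> _ [_ [a [b ->]] <-]; rewrite setTI.
apply: sub_sigma_algebra; apply: open_comp; last exact: itv_open.
by move=> x _; exact: coord_continuous.
Qed.

Lemma measurable_dotv d (T : measurableType d) n (f g : T -> borel_rV R n) :
  measurable_fun setT f -> measurable_fun setT g ->
  measurable_fun setT (fun x => dotv (f x : 'rV[R]_n) (g x)).
Proof.
move=> mf mg; apply: measurable_sum => i; apply: measurable_funM.
- exact: (measurableT_comp (measurable_coord i) mf).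
- exact: (measurableT_comp (measurable_coord i) mg).
Qed.

Lemma measurable_prod_coord n (g : 'I_n -> R -> R) :
  (forall i, measurable_fun setT (g i)) ->
  measurable_fun [set: borel_rV R n]
    (fun y : 'rV[R]_n => \prod_i g i (y ord0 i)).
Proof.
move=> mg; apply: measurable_prod => i _.
exact: (measurableT_comp (mg i) (measurable_coord i)).
Qed.

End measurability.

Section iterated.
Variables (R : realType) (n : nat).
Local Notation L := (lebesgue_measure_rV R).

Lemma ge0_integral_rVS (f : borel_rV R n.+1 -> \bar R) :
  measurable_fun setT f -> (forall x, 0 <= f x)%E ->
  (\int[L n.+1]_y f y =
   \int[@lebesgue_measure R]_t \int[L n]_x f (rV_cons (t, x)))%E.
Proof.
move=> mf f0.
have mc := @measurable_rV_cons R n.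
rewrite (@ge0_integral_pushforward _ _ _ _ _ (@rV_cons R n))//.
rewrite preimage_setT fubini_tonelli1//; last by move=> x; exact: f0.
exact: measurableT_comp.
Qed.

Lemma integral_rVS (f : borel_rV R n.+1 -> \bar R) :
  (L n.+1).-integrable setT f ->
  (\int[L n.+1]_y f y =
   \int[@lebesgue_measure R]_t \int[L n]_x f (rV_cons (t, x)))%E.
Proof.
move=> /integrableP[mf foo].
have mc := @measurable_rV_cons R n.
have fi : (@lebesgue_measure R \x L n)%E.-integrable setT (f \o @rV_cons R n).
  apply/integrableP; split; first exact: measurableT_comp.
  move: foo; rewrite ge0_integral_rVS//; last exact: measurableT_comp.
  rewrite -(@fubini_tonelli1 _ _ _ _ _ (@lebesgue_measure R) (L n)
    (abse \o (f \o @rV_cons R n)))//; last by move=> x; exact: abse_ge0.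
  by apply: measurableT_comp => //; apply: measurableT_comp.
have := @integral_pushforward _ _ _ _ _ _ mc
  (@lebesgue_measure R \x L n)%E setT f mf fi measurableT.
by rewrite preimage_setT -(integral12_prod_meas1 fi).
Qed.

End iterated.

Lemma ge0_integral_rV_prod (R : realType) (n : nat) (f : 'I_n -> R -> R)
    (c : 'I_n -> R) :
  (forall i, measurable_fun setT (f i)) -> (forall i x, 0 <= f i x) ->
  (forall i, \int[@lebesgue_measure R]_x (f i x)%:E = (c i)%:E)%E ->
  (\int[lebesgue_measure_rV R n]_y (\prod_i f i ((y : 'rV[R]_n) ord0 i))%:E
   = (\prod_i c i)%:E)%E.
Proof.
elim: n f c => [|n IH] f c mf f0 fc.
  rewrite integral_dirac//=; first by rewrite diracE in_setT mul1e !big_ord0.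
  by apply/measurable_EFinP; exact: measurable_prod_coord.
rewrite ge0_integral_rVS; last 2 first.
- by apply/measurable_EFinP; exact: measurable_prod_coord.
- by move=> x; rewrite lee_fin prodr_ge0.
under eq_integral => t _.
  under eq_integral => x _.
    rewrite big_ord_recl rV_consE0 /=.
    under eq_bigr do rewrite rV_consES.
    rewrite EFinM.
    over.
  rewrite ge0_integralZl//=; first last.
  - by rewrite lee_fin.
  - by move=> x _; rewrite lee_fin prodr_ge0.
  - apply/measurable_EFinP.
    exact: (@measurable_prod_coord R n (fun i => f (lift ord0 i))).
  rewrite (IH (fun i => f (lift ord0 i)) (fun i => c (lift ord0 i)))//.
  over.
have c0 i : 0 <= c i.
  by rewrite -lee_fin -fc integral_ge0// => x _; rewrite lee_fin.
rewrite /= ge0_integralZr//.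
- by rewrite fc -EFinM big_ord_recl.
- by apply/measurable_EFinP; exact: (mf ord0).
- by move=> x _; rewrite lee_fin.
- by rewrite lee_fin prodr_ge0.
Qed.

(** * The damping factor and its Fourier transform *)

(** The l1 norm makes the factor a product over the coordinates. *)
Definition damp (R : realType) (n : nat) (e : R) (y : 'rV[R]_n) : R :=
  expR (- (e * \sum_i `|y ord0 i|)).

(** The unnormalised Cauchy density: its total mass is [(2 pi)^n]. *)
Definition cauchy_kernel (R : realType) (n : nat) (e : R) (u : 'rV[R]_n) : R :=
  \prod_i (2 * e / (e ^+ 2 + u ord0 i ^+ 2)).

Section damp.
Variables (R : realType) (e : R).
Hypothesis e0 : 0 < e.

Lemma damp_prod n (y : 'rV[R]_n) : damp e y = \prod_i expR (- (e * `|y ord0 i|)).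
Proof. by rewrite /damp mulr_sumr -sumrN expR_sum. Qed.

Lemma damp_rV_cons n t (x : 'rV[R]_n) :
  damp e (rV_cons (t, x) : 'rV[R]_n.+1) = expR (- (e * `|t|)) * damp e x.
Proof.
rewrite !damp_prod big_ord_recl rV_consE0; congr (_ * _).
by apply: eq_bigr => i _; rewrite rV_consES.
Qed.

Lemma damp_ge0 n (y : 'rV[R]_n) : 0 <= damp e y.
Proof. exact: expR_ge0. Qed.

Lemma measurable_damp n : measurable_fun [set: borel_rV R n] (@damp R n e).
Proof.
rewrite (_ : @damp R n e = fun y => \prod_i expR (- (e * `|y ord0 i|))); last first.
  by apply/funext => y; rewrite damp_prod.
apply: (@measurable_prod_coord R n (fun=> fun t => expR (- (e * `|t|)))) => _.
apply: continuous_measurable_fun; exact: continuous_expRN_normr.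
Qed.

Lemma integrable_damp n :
  (lebesgue_measure_rV R n).-integrable setT (fun y => (damp e (y : 'rV[R]_n))%:E).
Proof.
apply/integrableP; split; first by apply/measurable_EFinP; exact: measurable_damp.
under eq_integral => y _ do rewrite gee0_abs ?lee_fin ?damp_ge0// damp_prod.
rewrite (@ge0_integral_rV_prod R n (fun=> fun t => expR (- (e * `|t|))) (fun=> 2 / e)).
- by rewrite ltry.
- by move=> _; apply: continuous_measurable_fun; exact: continuous_expRN_normr.
- by move=> _ t; exact: expR_ge0.
- by move=> _; exact: integral_expRN_normr.
Qed.

Lemma integrable_damp_cos n (u : 'rV[R]_n) (t : R) :
  (lebesgue_measure_rV R n).-integrable setT
    (fun y => (damp e y * cos (dotv u y + t))%:E).
Proof.
apply: le_integrable (integrable_damp n) => //.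
- apply/measurable_EFinP/measurable_funM; first exact: measurable_damp.
  apply: (measurableT_comp (continuous_measurable_fun (@continuous_cos R))).
  by apply: measurable_funD => //; exact: measurable_dotv.
- move=> y _; rewrite lee_fin normrM ler_piMr// ler_norml.
  by rewrite cos_geN1 cos_le1.
Qed.

(** In the inductive step the outer variable [s] only shifts the phase of the
    inner integral, by [u_0 s]; the induction hypothesis then leaves a
    one-dimensional integral of the same shape. *)
Lemma integral_damp_cos n (u : 'rV[R]_n) (t : R) :
  (\int[lebesgue_measure_rV R n]_y (damp e y * cos (dotv u y + t))%:E =
   (cos t * cauchy_kernel e u)%:E)%E.
Proof.
elim: n u t => [|n IH] u t.
  rewrite integral_dirac//=; last first.
    exact: (measurable_int _ (integrable_damp_cos u t)).
  rewrite diracE in_setT mul1e /damp /dotv /cauchy_kernel !big_ord0.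
  by rewrite mulr0 oppr0 expR0 mulr1 add0r mul1r.
rewrite integral_rVS; last exact: integrable_damp_cos.
pose u' : 'rV[R]_n := \row_j u ord0 (lift ord0 j).
have dotvS s x : dotv u (rV_cons (s, x) : 'rV[R]_n.+1) = u ord0 ord0 * s + dotv u' x.
  rewrite /dotv big_ord_recl rV_consE0; congr (_ + _).
  by apply: eq_bigr => i _; rewrite rV_consES mxE.
under eq_integral => s _.
  under eq_integral => x _.
    rewrite damp_rV_cons dotvS -mulrA addrAC addrC EFinM.
    over.
  rewrite integralZl//=; last exact: integrable_damp_cos.
  rewrite IH -EFinM mulrA EFinM.
  over.
rewrite /= integralZr//=; last first.
  apply: le_integrable (integrable_expRN_normr e0) => //.
  - apply/measurable_EFinP; apply: continuous_measurable_fun => s; apply: cvgM.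
      exact: continuous_expRN_normr.
    apply: continuous_comp; last exact: continuous_cos.
    by apply: cvgD; [apply: cvgM; [exact: cvg_cst|exact: cvg_id]|exact: cvg_cst].
  - move=> s _; rewrite lee_fin normrM ler_piMr// ler_norml.
    by rewrite cos_geN1 cos_le1.
rewrite integral_expRN_normr_cos// -EFinM -(mulrA (cos t)); congr (_ * _)%:E.
rewrite /cauchy_kernel big_ord_recl; congr (_ * _).
by apply: eq_bigr => i _; rewrite mxE.
Qed.

End damp.

(** * The Cauchy kernel over a box *)

Definition boxv (R : realType) (n : nat) (a b : 'rV[R]_n) : set (borel_rV R n) :=
  [set x : 'rV[R]_n | forall i, a ord0 i <= x ord0 i <= b ord0 i].

Section box.
Variables (R : realType) (e : R).
Hypothesis e0 : 0 < e.

Let den (s : R) : e ^+ 2 + s ^+ 2 != 0.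
Proof. by rewrite gt_eqF// ltr_wpDr ?sqr_ge0// exprn_gt0. Qed.

Lemma continuous_cauchy (x : R) :
  continuous (fun z : R => 2 * e / (e ^+ 2 + (x - z) ^+ 2)).
Proof.
move=> z; apply: cvgM; first exact: cvg_cst.
apply: cvgV; first exact: den.
apply: cvgD; first exact: cvg_cst.
apply: (@continuous_comp _ _ _ (fun z => x - z) (fun s => s ^+ 2)).
  by apply: cvgB; [exact: cvg_cst|exact: cvg_id].
exact: exprn_continuous.
Qed.

Lemma integral_itv_cauchy (a b x : R) : a < b ->
  (\int[@lebesgue_measure R]_(z in `[a, b]) (2 * e / (e ^+ 2 + (x - z) ^+ 2))%:E
   = (2 * (atan ((b - x) / e) - atan ((a - x) / e)))%:E)%E.
Proof.
move=> ab; pose F (z : R) : R := 2 * atan ((z - x) / e).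
have dF (z : R) : is_derive z (1:R) F (2 * e / (e ^+ 2 + (x - z) ^+ 2)).
  rewrite /F; apply: is_derive_eq.
  rewrite /GRing.scale/= ?(mulr1, mul1r, mulr0, addr0, subr0).
  have := den (x - z); have : e ^+ 2 + (z - x) ^+ 2 != 0 by exact: den.
  have : e != 0 by rewrite gt_eqF.
  by move=> ? ? ?; field; do ?[apply/andP; split].
have cF (z : R) : {for z, continuous F}.
  by apply/differentiable_continuous/derivable1_diffP; case: (dF z).
rewrite (@continuous_FTC2 _ _ F)//.
- by rewrite -EFinB /F mulrBr.
- by apply: continuous_subspaceT; exact: continuous_cauchy.
- split.
  + by move=> z _; case: (dF z).
  + by apply: cvg_at_right_filter; exact: cF.
  + by apply: cvg_at_left_filter; exact: cF.
- by move=> z _; rewrite derive1E (@derive_val _ _ _ _ _ _ _ (dF z)).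
Qed.

Lemma cauchy_kernel_ge0 n (u : 'rV[R]_n) : 0 <= cauchy_kernel e u.
Proof.
by rewrite prodr_ge0// => i _; rewrite divr_ge0 ?addr_ge0 ?sqr_ge0// mulr_ge0// ltW.
Qed.

Lemma integral_box_cauchy n (a b x : 'rV[R]_n) :
  (forall i, a ord0 i < b ord0 i) ->
  (\int[lebesgue_measure_rV R n]_z (cauchy_kernel e (x - z) * \1_(boxv a b) z)%:E =
   (\prod_i (2 * (atan ((b ord0 i - x ord0 i) / e) -
                  atan ((a ord0 i - x ord0 i) / e))))%:E)%E.
Proof.
move=> ab.
pose f i := (fun z => 2 * e / (e ^+ 2 + (x ord0 i - z) ^+ 2)) \_ `[a ord0 i, b ord0 i].
rewrite -(@ge0_integral_rV_prod R n f); first last.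
- move=> i; rewrite -integral_itv_cauchy// [RHS]integral_mkcond.
  by rewrite restrict_EFin.
- move=> i z; rewrite /f /patch; case: ifP => // _.
  by rewrite divr_ge0 ?addr_ge0 ?sqr_ge0// mulr_ge0// ltW.
- move=> i; apply/(measurable_restrictT _ _).1 => //.
  by apply: measurable_funTS; apply: continuous_measurable_fun; exact: continuous_cauchy.
apply: eq_integral => z _.
rewrite indicE; have [|zab] := boolP (z \in _).
  rewrite inE mulr1 => zab; congr EFin; apply: eq_bigr => i _.
  by rewrite /f patchE mem_set/= ?in_itv//= !mxE.
have [i zi] : exists i, ~ (a ord0 i <= (z : 'rV[R]_n) ord0 i <= b ord0 i).
  by apply/existsNP; move: zab; rewrite notin_setE.
by rewrite mulr0 (bigD1 i)//= /f patchE memNset ?mul0r.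
Qed.

End box.

(** * The damped inversion integral as a convolution *)

Section phase.
Variables (R : realType) (n : nat) (mu : probability (borel_rV R n) R).

Lemma cexpi (a : R) : cexp ('i%C * a%:C) = cos a +i* sin a.
Proof.
rewrite /cexp/= !mul0r !mul1r ?(subr0, add0r, addr0, sub0r, oppr0).
by rewrite expR0 !mul1r.
Qed.

Lemma cexpNi (a : R) : cexp (- ('i%C * a%:C)) = cos a +i* - sin a.
Proof. by rewrite -mulrN -raddfN cexpi cosN sinN. Qed.

Lemma integrable_norm_le1 (f : borel_rV R n -> R) : measurable_fun setT f ->
  (forall x, `|f x| <= 1) -> mu.-integrable setT (EFin \o f).
Proof.
move=> mf f1; apply: measurable_bounded_integrable => //.
  exact: (le_lt_trans (probability_le1 mu measurableT) (ltry 1)).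
by exists 1; split=> // M M1 x _; apply: (le_trans (f1 x)); exact: ltW.
Qed.

Lemma dotvBl (x z y : 'rV[R]_n) : dotv (x - z) y = dotv x y - dotv z y.
Proof.
by rewrite /dotv -sumrB; apply: eq_bigr => i _; rewrite !mxE mulrBl.
Qed.

(** The real part of [exp (i t) * chi y * exp (- i <z, y>)]. *)
Definition phased_integrand (t : R) (z y : 'rV[R]_n) : R :=
  complex.Re (char_fun mu y) * cos (dotv z y - t) +
  complex.Im (char_fun mu y) * sin (dotv z y - t).

Lemma phased_integrandE t z y :
  ((phased_integrand t z y)%:E =
   \int[mu]_x (cos (dotv (x - z : 'rV[R]_n) y + t))%:E)%E.
Proof.
have mc : measurable_fun setT (fun x : borel_rV R n => cos (dotv y (x : 'rV[R]_n))).
  apply: (measurableT_comp (continuous_measurable_fun (@continuous_cos R))).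
  exact: measurable_dotv.
have ms : measurable_fun setT (fun x : borel_rV R n => sin (dotv y (x : 'rV[R]_n))).
  apply: (measurableT_comp (continuous_measurable_fun (@continuous_sin R))).
  exact: measurable_dotv.
have icos : mu.-integrable setT (fun x => (cos (dotv y (x : 'rV[R]_n)))%:E).
  by apply: integrable_norm_le1 => // x; rewrite ler_norml cos_geN1 cos_le1.
have isin : mu.-integrable setT (fun x => (sin (dotv y (x : 'rV[R]_n)))%:E).
  by apply: integrable_norm_le1 => // x; rewrite ler_norml sin_geN1 sin_le1.
have chiE : char_fun mu y = (\int[mu]_x cos (dotv y (x : 'rV[R]_n))) +i*
    (\int[mu]_x sin (dotv y (x : 'rV[R]_n))).
  by congr Complex; apply: eq_Rintegral => x _; rewrite cexpi.
have ReE : (complex.Re (char_fun mu y))%:E =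
    (\int[mu]_x (cos (dotv y (x : 'rV[R]_n)))%:E)%E.
  by rewrite chiE/= /Rintegral fineK//; exact: integrable_fin_num.
have ImE : (complex.Im (char_fun mu y))%:E =
    (\int[mu]_x (sin (dotv y (x : 'rV[R]_n)))%:E)%E.
  by rewrite chiE/= /Rintegral fineK//; exact: integrable_fin_num.
have cosE (x : borel_rV R n) : (cos (dotv (x - z : 'rV[R]_n) y + t))%:E =
    ((cos (dotv y (x : 'rV[R]_n)))%:E * (cos (dotv z y - t))%:E +
     (sin (dotv y (x : 'rV[R]_n)))%:E * (sin (dotv z y - t))%:E)%E.
  rewrite -!EFinM -EFinD -cosB; congr (cos _)%:E.
  rewrite dotvBl (_ : dotv x y = dotv y x); first by ring.
  by apply: eq_bigr => i _; rewrite mulrC.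
under [RHS]eq_integral do rewrite cosE.
rewrite integralD//=; [|exact: integrableZr..].
by rewrite !integralZr//= -ReE -ImE -!EFinM -EFinD.
Qed.

Lemma measurable_phased_integrand :
  measurable_fun setT (fun y : borel_rV R n => complex.Re (char_fun mu y)) ->
  measurable_fun setT (fun y : borel_rV R n => complex.Im (char_fun mu y)) ->
  forall t z, measurable_fun setT (fun y : borel_rV R n => phased_integrand t z y).
Proof.
move=> mR mI t z.
have md : measurable_fun setT (fun y : borel_rV R n => dotv z (y : 'rV[R]_n) - t).
  by apply: measurable_funB => //; exact: measurable_dotv.
apply: measurable_funD; apply: measurable_funM => //.
- exact: (measurableT_comp (continuous_measurable_fun (@continuous_cos R))).
- exact: (measurableT_comp (continuous_measurable_fun (@continuous_sin R))).
Qed.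

(** A real part is bounded by the modulus; here this is the Cauchy-Schwarz
    inequality against a unit vector. *)
Lemma normr_phased_integrand t z y :
  `|phased_integrand t z y| <= Normc.normc (char_fun mu y).
Proof.
rewrite /phased_integrand; case: (char_fun mu y) => a b /=.
set s := _ - t.
rewrite -sqrtr_sqr ler_wsqrtr//.
have := cos2Dsin2 s; have := sqr_ge0 (a * sin s - b * cos s).
set c := cos s; set d := sin s => H1 H2.
have -> : a ^+ 2 + b ^+ 2 = (a ^+ 2 + b ^+ 2) * (c ^+ 2 + d ^+ 2).
  by rewrite H2 mulr1.
rewrite -subr_ge0; apply: le_trans H1 _; rewrite le_eqVlt; apply/orP; left.
by apply/eqP; ring.
Qed.

Variable (e : R).
Hypothesis e0 : 0 < e.

Lemma measurable_cauchy_kernelB :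
  measurable_fun setT (fun p : borel_rV R n * borel_rV R n =>
    cauchy_kernel e ((p.1 : 'rV[R]_n) - p.2)).
Proof.
apply: measurable_prod => i _.
have -> : (fun p : borel_rV R n * borel_rV R n =>
    2 * e / (e ^+ 2 + ((p.1 : 'rV[R]_n) - p.2) ord0 i ^+ 2)) =
  (fun s => 2 * e / (e ^+ 2 + (0 - s) ^+ 2)) \o
  (fun p : borel_rV R n * borel_rV R n =>
    (p.1 : 'rV[R]_n) ord0 i - (p.2 : 'rV[R]_n) ord0 i).
  by apply/funext => p /=; rewrite !mxE; congr (_ / (_ + _)); ring.
apply: measurableT_comp.
  apply: continuous_measurable_fun; exact: continuous_cauchy.
apply: measurable_funB.
- exact: (measurableT_comp (measurable_coord i)).
- exact: (measurableT_comp (measurable_coord i)).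
Qed.

(** Fubini for [damp e y * cos (<x - z, y> + t)], which is integrable on the
    product since [mu] is finite and the damping factor is integrable. *)
Lemma integral_damp_phased t (z : 'rV[R]_n) :
  (\int[lebesgue_measure_rV R n]_y (damp e y * phased_integrand t z y)%:E =
   \int[mu]_x (cos t * cauchy_kernel e ((x : 'rV[R]_n) - z))%:E)%E.
Proof.
pose f (p : borel_rV R n * borel_rV R n) : R :=
  damp e p.1 * cos (dotv ((p.2 : 'rV[R]_n) - z) p.1 + t).
have mf : measurable_fun setT f.
  apply: measurable_funM.
    exact: (measurableT_comp (@measurable_damp R e n)).
  apply: (measurableT_comp (continuous_measurable_fun (@continuous_cos R))).
  apply: measurable_funD => //.
  under eq_fun do rewrite dotvBl.
  by apply: measurable_funB; exact: measurable_dotv.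
have fi : (lebesgue_measure_rV R n \x mu)%E.-integrable setT (EFin \o f).
  apply/(integrable12ltyP _ mu); first exact/measurable_EFinP.
  have mN : measurable_fun setT (fun y : borel_rV R n =>
      \int[mu]_x `|(EFin \o f) (y, x)|)%E.
    apply: (@measurable_fun_fubini_tonelli_F _ _ _ _ _ mu (abse \o (EFin \o f))) => //.
      by apply: measurableT_comp => //; exact/measurable_EFinP.
    by move=> x; exact: abse_ge0.
  have /integrableP[md] := integrable_damp e0 n.
  apply: le_lt_trans; apply: ge0_le_integral => //.
  - by move=> y _; exact: integral_ge0.
  - exact: measurableT_comp.
  - move=> y _ /=.
    apply: (@le_trans _ _ ((damp e (y : 'rV[R]_n))%:E * mu setT)%E).
      apply: (@integral_le_bound _ _ _ mu setT (fun x => (f (y, x))%:E)) => //.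
      - by apply/measurable_EFinP; exact: (measurableT_comp mf (pair1_measurable y)).
      - by rewrite lee_fin damp_ge0.
      - apply: aeW => x _; rewrite lee_fin /f normrM (ger0_norm (damp_ge0 _ _)).
        by rewrite ler_piMr ?damp_ge0// ler_norml cos_geN1 cos_le1.
    by rewrite [mu _]probability_setT mule1 lee_fin ler_norm.
have ic (y : 'rV[R]_n) :
    mu.-integrable setT (fun x => (cos (dotv ((x : 'rV[R]_n) - z) y + t))%:E).
  apply: integrable_norm_le1 => [|x]; last by rewrite ler_norml cos_geN1 cos_le1.
  apply: (measurableT_comp (continuous_measurable_fun (@continuous_cos R))).
  apply: measurable_funD => //; under eq_fun do rewrite dotvBl.
  by apply: measurable_funB => //; exact: measurable_dotv.
have := Fubini fi; rewrite /f/=.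
under eq_integral => y _.
  under eq_integral => x _ do rewrite EFinM.
  rewrite integralZl//=.
  rewrite -phased_integrandE -EFinM.
  over.
move=> ->; apply: eq_integral => x _.
by rewrite (integral_damp_cos e0).
Qed.

End phase.

(** * Closed boxes generate the Borel sets *)

Section boxes.
Variables (R : realType) (n : nat).

Definition boxes : set (set (borel_rV R n)) :=
  [set A | exists a b, A = boxv a b].

Lemma setI_closed_boxes : setI_closed boxes.
Proof.
move=> _ _ [a [b ->]] [c [d ->]].
exists (\row_i Num.max (a ord0 i) (c ord0 i)), (\row_i Num.min (b ord0 i) (d ord0 i)).
apply/seteqP; split=> [x [ab cd] i|x xP].
  rewrite !mxE ge_max le_min.
  by move: (ab i) (cd i) => /andP[-> ->] /andP[-> ->].
by split=> i; move: (xP i); rewrite !mxE ge_max le_min;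
  move=> /andP[/andP[? ?] /andP[? ?]]; exact/andP.
Qed.

(** Rational corners keep the union countable. *)
Lemma open_rational_boxes (U : set 'rV[R]_n) : open U ->
  U = \bigcup_(q : 'rV[rat]_n * 'rV[rat]_n)
    [set x | boxv (map_mx ratr q.1) (map_mx ratr q.2) `<=` U /\
             boxv (map_mx ratr q.1) (map_mx ratr q.2) x].
Proof.
move=> oU; apply/seteqP; split; last by move=> x [q _ [+ qx]]; exact.
move=> x Ux.
move: oU; rewrite openE => /(_ _ Ux)/nbhs_ballP[e /= e0 eU].
have /choice[p pP] (i : 'I_n) : exists p : rat, x ord0 i - e < ratr p < x ord0 i.
  have [p /itvP pP] := @rat_in_itvoo R (x ord0 i - e) (x ord0 i)
    ltac:(by rewrite gtrBl).
  by exists p; rewrite !pP.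
have /choice[q qP] (i : 'I_n) : exists q : rat, x ord0 i < ratr q < x ord0 i + e.
  have [q /itvP qP] := @rat_in_itvoo R (x ord0 i) (x ord0 i + e)
    ltac:(by rewrite ltrDl).
  by exists q; rewrite !qP.
exists (\row_i p i, \row_i q i) => //=; split.
  move=> y yP; apply: eU; split => // i j; rewrite (ord1 i) /ball/= ltr_distlC.
  have := yP j; rewrite !mxE => /andP[py yq].
  have /andP[xp _] := pP j; have /andP[_ qx] := qP j.
  by rewrite (lt_le_trans xp py) (le_lt_trans yq qx).
move=> i; rewrite !mxE; have /andP[_ /ltW->] := pP i.
by have /andP[/ltW-> _] := qP i.
Qed.

Lemma measurable_gen_boxes : measurable = <<s boxes >> :> set (set (borel_rV R n)).
Proof.
apply/seteqP; split.
  apply: smallest_sub; first exact: smallest_sigma_algebra.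
  move=> U oU; rewrite (open_rational_boxes oU).
  apply: (@countable_bigcupT_measurable _
    (@g_sigma_algebraType (borel_rV R n) boxes)).
    exact: countableP.
  move=> [p q] /=.
  have [pqU|pqU] := pselect
    (boxv (map_mx ratr p : 'rV[R]_n) (map_mx ratr q) `<=` U); last first.
    rewrite (_ : mkset _ = set0); first exact: measurable0.
    by rewrite -subset0 => x [].
  rewrite (_ : mkset _ = boxv (map_mx ratr p : 'rV[R]_n) (map_mx ratr q)).
    by apply: sub_sigma_algebra; do 2 eexists.
  by apply/seteqP; split=> x; [case|].
apply: smallest_sub; first exact: sigma_algebra_measurable.
by move=> _ [a [b ->]]; exact: measurable_rV_box.
Qed.

Lemma bigcup_boxv :
  \bigcup_k boxv (const_mx (- k%:R) : 'rV[R]_n) (const_mx k%:R) = setT.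
Proof.
apply/seteqP; split => // x _.
exists (\max_i (Num.truncn `|(x : 'rV[R]_n) ord0 i|).+1)%N => // i; rewrite !mxE.
rewrite -ler_norml (le_trans (ltW (truncnS_gt _)))// ler_nat.
exact: (leq_bigmax i).
Qed.

End boxes.

(** * Measures given by a density *)

Section density.
Context d (T : measurableType d) (R : realType).
Variables (nu : {measure set T -> \bar R}) (f : T -> R).
Hypotheses (mf : measurable_fun setT f) (f0 : forall x, 0 <= f x).

(** The two proofs are arguments so that the measure structure below can be
    inferred from the term alone. *)
Definition density_measure of measurable_fun setT f & (forall x, 0 <= f x) :=
  fun A => (\int[nu]_(x in A) (f x)%:E)%E.

Local Notation mnu := (density_measure mf f0).

Let mnu0 : mnu set0 = 0%E.
Proof. by rewrite /mnu integral_set0. Qed.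

Let mnu_ge0 A : (0 <= mnu A)%E.
Proof. by apply: integral_ge0 => x _; rewrite lee_fin. Qed.

Let mnu_sigma_additive : semi_sigma_additive mnu.
Proof.
apply: semi_sigma_additive_nng_induced; first exact/measurable_EFinP.
by move=> x; rewrite lee_fin.
Qed.

HB.instance Definition _ := isMeasure.Build _ _ _ mnu
  mnu0 mnu_ge0 mnu_sigma_additive.

End density.

(** * Arctangents at the chosen rates *)

Section rates.
Variable R : realType.

Definition width (k : nat) : R := k.+1%:R^-1.

Lemma width_gt0 k : 0 < width k.
Proof. by rewrite invr_gt0. Qed.

Lemma cvg_width : width k @[k --> \oo] --> 0.
Proof. exact: cvg_harmonic. Qed.

(** The argument is [s (k + 1)^2 + (k + 1)]: the quadratic term decides unless
    [s = 0], where the linear term pushes the limit to [pi / 2]. *)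
Lemma cvg_atan_width (s : R) :
  atan ((s + width k) / width k ^+ 2) @[k --> \oo] -->
    (if 0 <= s then pi / 2 else - (pi / 2)).
Proof.
have wE k : (s + width k) / width k ^+ 2 = s * k.+1%:R ^+ 2 + k.+1%:R.
  have : k.+1%:R != 0 :> R by rewrite pnatr_eq0.
  by rewrite /width; set K := k.+1%:R => K0; field.
case: ifPn => [s0|]; last rewrite -ltNge => s0.
  apply: (@cvg_comp _ _ _ (fun k => (s + width k) / width k ^+ 2)
    (@atan R) _ (pinfty_nbhs R)); last exact: cvgy_atan.
  apply: (@ger_cvgy _ _ _ _ (fun k : nat => k%:R)); last exact: cvgr_idn.
  near=> k; rewrite wE; have := mulr_ge0 s0 (sqr_ge0 (k.+1%:R : R)).
  by rewrite -natr1; lra.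
rewrite (_ : (fun k => _) =
    fun k => - atan (- ((s + width k) / width k ^+ 2))); last first.
  by apply/funext => k; rewrite atanN opprK.
apply: cvgN; apply: (@cvg_comp _ _ _ (fun k => - ((s + width k) / width k ^+ 2))
  (@atan R) _ (pinfty_nbhs R)); last exact: cvgy_atan.
apply: (@ger_cvgy _ _ _ _ (fun k : nat => k%:R)); last exact: cvgr_idn.
near=> k; rewrite wE.
have : 2 / - s <= k%:R by near: k; exact: nbhs_infty_ger.
rewrite ler_pdivrMr ?oppr_gt0// => sk.
have := ler0n R k; rewrite -natr1; nra.
Unshelve. all: by end_near. Qed.

End rates.

(** * Fourier inversion *)

Section inversion.
Variables (R : realType) (n : nat) (mu : probability (borel_rV R n) R).
Local Notation L := (lebesgue_measure_rV R n).
Local Notation chi := (char_fun mu).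
Hypothesis ichi : cintegrable L chi.

Let rate (k : nat) : R := width R k ^+ 2.

Let rate_gt0 k : 0 < rate k.
Proof. by rewrite exprn_gt0// width_gt0. Qed.

Let integrable_normc : L.-integrable setT (fun y => (Normc.normc (chi y))%:E).
Proof.
case: ichi => mR mI foo; apply/integrableP; split.
  apply/measurable_EFinP.
  rewrite (_ : (fun y => _) = (fun y =>
      Num.sqrt (complex.Re (chi y) ^+ 2 + complex.Im (chi y) ^+ 2))).
    apply: (measurableT_comp (continuous_measurable_fun (@sqrt_continuous R))).
    by apply: measurable_funD; exact: measurable_funX.
  by apply/funext => y; case: (chi y).
under eq_integral => y _.
  rewrite gee0_abs ?lee_fin; last by case: (chi y) => a b; exact: sqrtr_ge0.
  over.
by [].
Qed.

Let mph t z : measurable_fun setT (fun y : borel_rV R n => phased_integrand mu t z y).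
Proof. by case: ichi => mR mI _; exact: measurable_phased_integrand. Qed.

Let integrable_phased t z :
  L.-integrable setT (fun y => (phased_integrand mu t z y)%:E).
Proof.
apply: le_integrable integrable_normc => //; first exact/measurable_EFinP.
by move=> y _; rewrite lee_fin (le_trans (normr_phased_integrand _ _ _ _))// ler_norm.
Qed.

Let damp_le1 k (y : 'rV[R]_n) : damp (rate k) y <= 1.
Proof.
rewrite /damp -expR0 ler_expR oppr_le0 mulr_ge0 ?(ltW (rate_gt0 k))//.
by rewrite sumr_ge0.
Qed.

Let normr_damp_phased t z k y :
  `|damp (rate k) y * phased_integrand mu t z y| <= Normc.normc (chi y).
Proof.
rewrite normrM (ger0_norm (damp_ge0 _ _)).
by apply: le_trans (normr_phased_integrand mu t z y); rewrite ler_piMl.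
Qed.

Let mdamp_phased t z k : measurable_fun setT
  (fun y : borel_rV R n => damp (rate k) y * phased_integrand mu t z y).
Proof. by apply: measurable_funM => //; exact: measurable_damp. Qed.

Let cvg_rate : rate k @[k --> \oo] --> (0 : R).
Proof.
by rewrite -[X in _ --> X](mulr0 (0 : R)); apply: cvgM; exact: cvg_width.
Qed.

Let cvg_damp (y : 'rV[R]_n) : damp (rate k) y @[k --> \oo] --> (1 : R).
Proof.
rewrite (_ : 1 = expR (- (0 * \sum_i `|y ord0 i|))); last first.
  by rewrite mul0r oppr0 expR0.
apply: (@cvg_comp _ _ _ (fun k => - (rate k * \sum_i `|y ord0 i|)) (@expR R));
  last exact: continuous_expR.
apply: cvgN; apply: cvgM; last exact: cvg_cst.
exact: cvg_rate.
Qed.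

Let cvg_damped t z :
  (\int[L]_y (damp (rate k) y * phased_integrand mu t z y)%:E)%E @[k --> \oo] -->
  (\int[L]_y (phased_integrand mu t z y)%:E)%E.
Proof.
have [] := @dominated_convergence _ _ _ L setT measurableT
  (fun k y => (damp (rate k) y * phased_integrand mu t z y)%:E)
  (fun y => (phased_integrand mu t z y)%:E)
  (fun y => (Normc.normc (chi y))%:E) => //.
- by move=> k; exact/measurable_EFinP.
- exact/measurable_EFinP.
- apply: aeW => y _; apply: cvg_EFin; first exact: nearW.
  rewrite -[X in _ --> X]mul1r; apply: cvgM => //; exact: cvg_cst.
- by apply: aeW => y k _; rewrite lee_fin.
Qed.

Definition inversion_integral (t : R) (z : 'rV[R]_n) : R :=
  \int[L]_y phased_integrand mu t z y.

Let inversionE t z :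
  (inversion_integral t z)%:E = (\int[L]_y (phased_integrand mu t z y)%:E)%E.
Proof.
by rewrite /inversion_integral /Rintegral fineK//; exact: integrable_fin_num.
Qed.

(** A limit of integrals of Cauchy kernels against [mu]. *)
Lemma inversion_ge0 z : 0 <= inversion_integral 0 z.
Proof.
rewrite -lee_fin inversionE; apply: (cvge_to_ge (@cvg_damped 0 z)).
apply: nearW => k; rewrite integral_damp_phased//.
by apply: integral_ge0 => x _; rewrite lee_fin cos0 mul1r cauchy_kernel_ge0.
Qed.

(** The phase [- pi / 2] is the imaginary part, and each damped integral carries
    the factor [cos (- pi / 2)]. *)
Lemma inversion_pihalf z : inversion_integral (- (pi / 2)) z = 0.
Proof.
apply: EFin_inj; rewrite inversionE.
apply: (cvg_unique _ (@cvg_damped _ z)) => //.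
apply: cvg_near_cst; apply: nearW => k; rewrite integral_damp_phased//.
by apply: integral0_eq => x _; rewrite cosN cos_pihalf mul0r.
Qed.

Let smoothed k (z : 'rV[R]_n) : R :=
  \int[L]_y (damp (rate k) y * phased_integrand mu 0 z y).

Let smoothedE k z :
  ((smoothed k z)%:E = \int[L]_y (damp (rate k) y * phased_integrand mu 0 z y)%:E)%E.
Proof.
rewrite /smoothed /Rintegral fineK//; apply: integrable_fin_num => //.
apply: le_integrable integrable_normc => //; first exact/measurable_EFinP.
by move=> y _; rewrite lee_fin (le_trans (normr_damp_phased _ _ _ _))// ler_norm.
Qed.

Let smoothed_mu k z :
  ((smoothed k z)%:E = \int[mu]_x (cauchy_kernel (rate k) ((x : 'rV[R]_n) - z))%:E)%E.
Proof.
rewrite smoothedE integral_damp_phased//.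
by apply: eq_integral => x _; rewrite cos0 mul1r.
Qed.

Let smoothed_ge0 k z : 0 <= smoothed k z.
Proof.
rewrite -lee_fin smoothed_mu integral_ge0// => x _.
by rewrite lee_fin cauchy_kernel_ge0.
Qed.

Let smoothed_le k z : smoothed k z <= \int[L]_y Normc.normc (chi y).
Proof.
rewrite -lee_fin smoothedE /Rintegral fineK//; last exact: integrable_fin_num.
apply: le_integral => //.
  apply: le_integrable integrable_normc => //; first exact/measurable_EFinP.
  by move=> y _; rewrite lee_fin (le_trans (normr_damp_phased _ _ _ _))// ler_norm.
by move=> y _; rewrite lee_fin (le_trans (ler_norm _)).
Qed.

Let cvg_smoothed z : smoothed k z @[k --> \oo] --> inversion_integral 0 z.
Proof.
have := @cvg_damped 0 z; rewrite -inversionE.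
by under eq_fun do rewrite -smoothedE; move/fine_cvg.
Qed.

Let measurable_smoothed k : measurable_fun [set: borel_rV R n] (smoothed k).
Proof.
apply/measurable_EFinP.
rewrite (_ : _ \o _ = fubini_G mu (fun p : borel_rV R n * borel_rV R n =>
    (cauchy_kernel (rate k) ((p.1 : 'rV[R]_n) - p.2))%:E)); last first.
  by apply/funext => z; rewrite /= smoothed_mu.
apply: measurable_fun_fubini_tonelli_G.
  by apply/measurable_EFinP; exact: measurable_cauchy_kernelB.
by move=> p; rewrite lee_fin cauchy_kernel_ge0.
Qed.

Lemma measurable_inversion :
  measurable_fun [set: borel_rV R n] (inversion_integral 0).
Proof.
by apply: (measurable_fun_cvg measurable_smoothed) => z _; exact: cvg_smoothed.
Qed.

(** * The inversion integral over a closed box *)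

Section fixed_box.
Variables a b : 'rV[R]_n.
Hypothesis ab : forall i, a ord0 i <= b ord0 i.

Let wbox k := boxv (a - const_mx (width R k)) (b + const_mx (width R k)).

Let measurable_wbox k : measurable (wbox k).
Proof. exact: measurable_rV_box. Qed.

(* The integral of the one-dimensional kernel centred at x_i over the enlarged
   side [a_i - w, b_i + w], with s = b_i - x_i and t = x_i - a_i. *)
Let factor k (s t : R) : R :=
  2 * (atan ((s + width R k) / rate k) + atan ((t + width R k) / rate k)).

Let integral_smoothed k :
  (\int[L]_z (smoothed k z * \1_(wbox k) z)%:E =
   \int[mu]_x (\prod_i factor k (b ord0 i - (x : 'rV[R]_n) ord0 i)
                                 ((x : 'rV[R]_n) ord0 i - a ord0 i))%:E)%E.
Proof.
pose f (p : borel_rV R n * borel_rV R n) : \bar R :=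
  (cauchy_kernel (rate k) ((p.1 : 'rV[R]_n) - p.2) * \1_(wbox k) p.2)%:E.
have mf : measurable_fun setT f.
  apply/measurable_EFinP/measurable_funM; first exact: measurable_cauchy_kernelB.
  exact: (measurableT_comp (measurable_indic (measurable_wbox k))).
have f0 p : (0 <= f p)%E by rewrite lee_fin mulr_ge0// cauchy_kernel_ge0.
transitivity (\int[L]_z \int[mu]_x f (x, z))%E.
  apply: eq_integral => z _; rewrite EFinM smoothed_mu.
  under [RHS]eq_integral do rewrite /f EFinM/=.
  rewrite ge0_integralZr//.
  - apply/measurable_EFinP.
    exact: (measurableT_comp (measurable_cauchy_kernelB (rate_gt0 k))
      (pair2_measurable z)).
  - by move=> x _; rewrite lee_fin cauchy_kernel_ge0.
rewrite -(@fubini_tonelli _ _ _ _ _ mu L f mf f0); apply: eq_integral => x _.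
rewrite integral_box_cauchy//; last first.
  by move=> i; rewrite !mxE; have := width_gt0 R k; have := ab i; lra.
congr EFin; apply: eq_bigr => i _; rewrite !mxE /factor; congr (2 * (_ + _)).
  by congr (atan (_ / _)); ring.
by rewrite -atanN -mulNr; congr (atan (_ / _)); ring.
Qed.

Let cvg_indic_wbox z : (\1_(wbox k) z : R) @[k --> \oo] --> (\1_(boxv a b) z : R).
Proof.
apply: cvg_near_cst.
have [/set_mem zab|] := boolP (z \in boxv a b).
  apply: nearW => k; rewrite !indicE !mem_set// => i; rewrite !mxE.
  by have := zab i; have := width_gt0 R k; move=> ? /andP[? ?]; apply/andP; split; lra.
rewrite notin_setE => nzab; have /existsNP[i zi] := nzab.
have [s s0 sz] : exists2 s : R, 0 < s & forall k, width R k < s -> ~ wbox k z.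
  have [za|az] := ltP ((z : 'rV[R]_n) ord0 i) (a ord0 i).
    exists (a ord0 i - (z : 'rV[R]_n) ord0 i); first by rewrite subr_gt0.
    by move=> k kz /(_ i); rewrite !mxE => /andP[+ _]; lra.
  have [bz|zb] := ltP (b ord0 i) ((z : 'rV[R]_n) ord0 i).
    exists ((z : 'rV[R]_n) ord0 i - b ord0 i); first by rewrite subr_gt0.
    by move=> k kz /(_ i); rewrite !mxE => /andP[_]; lra.
  by case: zi; rewrite az zb.
near=> k; rewrite !indicE !memNset//; apply: sz.
rewrite -[ltLHS]ger0_norm ?ltW ?width_gt0//; near: k.
by have /cvgr0_norm_lt := @cvg_width R; exact.
Unshelve. all: by end_near. Qed.

Let cvg_smoothed_box :
  (\int[L]_z (smoothed k z * \1_(wbox k) z)%:E)%E @[k --> \oo] -->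
  (\int[L]_z (inversion_integral 0 z * \1_(boxv a b) z)%:E)%E.
Proof.
pose M := \int[L]_y Normc.normc (chi y).
have [] := @dominated_convergence _ _ _ L setT measurableT
  (fun k z => (smoothed k z * \1_(wbox k) z)%:E)
  (fun z => (inversion_integral 0 z * \1_(boxv a b) z)%:E)
  (fun z => (M * \1_(wbox 0) z)%:E) => //.
- move=> k; apply/measurable_EFinP/measurable_funM; first exact: measurable_smoothed.
  exact: measurable_indic.
- apply/measurable_EFinP/measurable_funM; first exact: measurable_inversion.
  by apply: measurable_indic; exact: measurable_rV_box.
- apply: aeW => z _; apply: cvg_EFin; first exact: nearW.
  by apply: cvgM; [exact: cvg_smoothed|exact: cvg_indic_wbox].
- under eq_fun do rewrite EFinM.
  apply: integrableZl => //; apply/integrableP; split.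
    exact/measurable_EFinP/measurable_indic.
  under eq_integral do rewrite gee0_abs ?lee_fin//.
  rewrite integral_indic// setIT.
  have ab0 i : (a - const_mx (width R 0)) ord0 i <= (b + const_mx (width R 0)) ord0 i.
    by rewrite !mxE; have := width_gt0 R 0; have := ab i; lra.
  by rewrite [ltLHS](lebesgue_measure_rV_box ab0) ltry.
- apply: aeW => z k _; rewrite lee_fin normrM ger0_norm// ger0_norm// ler_pM//.
  rewrite !indicE ler_nat; have [/set_mem zk|//] := boolP (z \in wbox k).
  rewrite mem_set// => i; have := zk i; rewrite !mxE => /andP[h1 h2].
  have : width R k <= width R 0 by rewrite lef_pV2 ?posrE// ler_nat.
  by move=> ?; apply/andP; split; lra.
Qed.

Let factor_bound k s t : `|factor k s t| <= 2 * pi.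
Proof.
rewrite /factor normrM (ger0_norm (_ : 0 <= 2))// ler_wpM2l//.
rewrite ler_norml; set u := _ / _; set v := _ / _.
have := atan_gtNpi2 u; have := atan_gtNpi2 v.
have := atan_ltpi2 u; have := atan_ltpi2 v.
by move=> ? ? ? ?; apply/andP; split; lra.
Qed.

Let mfactor k : measurable_fun setT (fun x : borel_rV R n =>
  \prod_i factor k (b ord0 i - (x : 'rV[R]_n) ord0 i)
                                 ((x : 'rV[R]_n) ord0 i - a ord0 i)).
Proof.
apply: (@measurable_prod_coord R n
  (fun i s => factor k (b ord0 i - s) (s - a ord0 i))) => i.
have mh : measurable_fun setT (fun u : R => atan ((u + width R k) / rate k)).
  apply: continuous_measurable_fun => u.
  apply: (@continuous_comp _ _ _ (fun u => (u + width R k) / rate k) (@atan R));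
    last exact: continuous_atan.
  by apply: cvgM; [apply: cvgD; [exact: cvg_id|]|]; exact: cvg_cst.
apply: measurable_funM => //; apply: measurable_funD.
- by apply: (measurableT_comp mh); exact: measurable_funB.
- by apply: (measurableT_comp mh); exact: measurable_funB.
Qed.

(* Of s = b_i - x_i and t = x_i - a_i at most one is negative, because
   a_i <= b_i: the limits pi / 2 then either add up or cancel. *)
Let cvg_factor (x : borel_rV R n) :
  \prod_i factor k (b ord0 i - (x : 'rV[R]_n) ord0 i)
                   ((x : 'rV[R]_n) ord0 i - a ord0 i) @[k --> \oo] -->
  (2 * pi) ^+ n * \1_(boxv a b) x.
Proof.
pose l (i : 'I_n) : R :=
  (2 * pi) * (a ord0 i <= (x : 'rV[R]_n) ord0 i <= b ord0 i)%R%:R.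
rewrite (_ : _ * _ = \prod_i l i); last first.
  rewrite /l big_split/= prodr_const card_ord; congr (_ * _); rewrite indicE.
  have [/set_mem xab|] := boolP (x \in boxv a b).
    by rewrite big1// => i _; rewrite xab.
  rewrite notin_setE => /existsNP[i /negP/negbTE xi].
  by rewrite (bigD1 i)//= xi mul0r.
apply: cvg_big; first exact: mul_continuous.
move=> i _.
have h1 := @cvg_atan_width R (b ord0 i - (x : 'rV[R]_n) ord0 i).
have h2 := @cvg_atan_width R ((x : 'rV[R]_n) ord0 i - a ord0 i).
have -> : l i = 2 *
   ((if 0 <= b ord0 i - (x : 'rV[R]_n) ord0 i then pi / 2 else - (pi / 2)) +
    (if 0 <= (x : 'rV[R]_n) ord0 i - a ord0 i then pi / 2 else - (pi / 2))).
  rewrite /l !subr_ge0; have abi := ab i.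
  by case: leP => ax; case: leP => xb /=; rewrite ?(mulr1, mulr0); lra.
by apply: cvgM; [exact: cvg_cst|exact: cvgD].
Qed.

(** Both sides are limits of the integrals of the damped functions over the
    enlarged boxes: on the right by dominated convergence for Lebesgue measure
    ([|chi|] is integrable and the boxes are bounded), on the left by dominated
    convergence for [mu]. *)
Lemma inversion_box :
  (((2 * pi) ^+ n)%:E * mu (boxv a b) =
   \int[L]_z (inversion_integral 0 z * \1_(boxv a b) z)%:E)%E.
Proof.
have mab : measurable (boxv a b) by exact: measurable_rV_box.
have [] := @dominated_convergence _ _ _ mu setT measurableT
  (fun k x => (\prod_i factor k (b ord0 i - (x : 'rV[R]_n) ord0 i)
                                 ((x : 'rV[R]_n) ord0 i - a ord0 i))%:E)
  (fun x => ((2 * pi) ^+ n * \1_(boxv a b) x)%:E)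
  (fun=> ((2 * pi) ^+ n)%:E) => //.
- by move=> k; exact/measurable_EFinP.
- by apply/measurable_EFinP/measurable_funM => //; exact: measurable_indic.
- apply: aeW => x _; apply: cvg_EFin; first exact: nearW.
  exact: cvg_factor.
- exact: (finite_measure_integrable_cst mu).
- apply: aeW => x k _; rewrite lee_fin normr_prod.
  rewrite -[in leRHS](card_ord n) -prodr_const ler_prod// => i _.
  by rewrite normr_ge0/=.
move=> _ _ cvg_mu.
have <- : (\int[mu]_x ((2 * pi) ^+ n * \1_(boxv a b) x)%:E =
    ((2 * pi) ^+ n)%:E * mu (boxv a b))%E.
  under eq_integral do rewrite EFinM.
  rewrite ge0_integralZl//=.
  - by rewrite integral_indic// setIT.
  - by apply/measurable_EFinP; exact: measurable_indic.
  - by rewrite lee_fin exprn_ge0// mulr_ge0// pi_ge0.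
apply: (cvg_unique _ cvg_mu) => //.
rewrite (_ : (fun k => _) =
    fun k => (\int[L]_z (smoothed k z * \1_(wbox k) z)%:E)%E) //.
by apply/funext => k; rewrite integral_smoothed.
Qed.

End fixed_box.

End inversion.

Theorem theorem1p2 (R : realType) (d : nat) (d_ge1 : (1 <= d)%N)
    (mu : probability (borel_rV R d) R) :
  cintegrable (lebesgue_measure_rV R d) (char_fun mu) ->
  mu `<< lebesgue_measure_rV R d /\
  exists g : borel_rV R d -> R,
    is_pdf mu (lebesgue_measure_rV R d) g /\
    forall z : borel_rV R d,
      (g z)%:C = ((2 * pi) ^+ d)^-1%:C *
        cintegral (lebesgue_measure_rV R d)
          (fun y : borel_rV R d => char_fun mu y * cexp (- ('i%C * (dotv z y)%:C))).
Proof.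
move=> ichi.
pose c : R := (2 * pi) ^+ d.
have c0 : 0 < c by rewrite exprn_gt0// mulr_gt0// pi_gt0.
pose g (z : borel_rV R d) : R := c^-1 * inversion_integral mu 0 z.
have mg : measurable_fun setT g.
  by apply: measurable_funM => //; exact: measurable_inversion.
have g0 z : 0 <= g z.
  by rewrite mulr_ge0 ?invr_ge0 ?(ltW c0)//; exact: inversion_ge0.
have mu_density A : measurable A ->
    mu A = (\int[lebesgue_measure_rV R d]_(z in A) (g z)%:E)%E.
  move=> mA.
  apply: (measure_unique (@boxes R d) _ (@measurable_gen_boxes R d)
    (@setI_closed_boxes R d) _ (@bigcup_boxv R d) mu
    (density_measure (lebesgue_measure_rV R d) mg g0)) => //.
  - by move=> k; exists (const_mx (- k%:R)), (const_mx k%:R).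
  - move=> _ [a [b ->]].
    have [ab|] := pselect (forall i, a ord0 i <= b ord0 i); last first.
      move=> /existsNP[i /negP]; rewrite -ltNge => ba.
      rewrite (_ : boxv a b = set0) ?measure0// -subset0 => x /(_ i) /andP[ax xb].
      by move: (le_trans ax xb); rewrite leNgt ba.
    have mab : measurable (boxv a b) by exact: measurable_rV_box.
    rewrite /= /density_measure integral_mkcond.
    transitivity (\int[lebesgue_measure_rV R d]_z
      (c^-1%:E * (inversion_integral mu 0 z * \1_(boxv a b) z)%:E))%E; last first.
      apply: eq_integral => z _; rewrite patchE indicE.
      by case: ifP => _; rewrite -EFinM ?mulr1// !mulr0.
    rewrite ge0_integralZl//=.
    + by rewrite -inversion_box// muleA -EFinM mulVf ?gt_eqF// mul1e.
    + apply/measurable_EFinP/measurable_funM; first exact: measurable_inversion.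
      exact: measurable_indic.
    + by move=> z _; rewrite lee_fin mulr_ge0//; exact: inversion_ge0.
    + by rewrite lee_fin invr_ge0 ltW.
  - move=> k; apply: (le_lt_trans _ (ltry 1)); apply: probability_le1.
    exact: measurable_rV_box.
split.
  apply/null_content_dominatesP => A mA LA0; rewrite mu_density//.
  by apply: null_set_integral => //; apply/measurable_EFinP; exact: measurable_funTS.
exists g; split=> // z.
rewrite (_ : cintegral _ _ = (inversion_integral mu 0 z)%:C).
  by rewrite -rmorphM.
rewrite [RHS](_ : _ = inversion_integral mu 0 z +i*
    inversion_integral mu (- (pi / 2)) z); last first.
  by rewrite inversion_pihalf.
congr Complex; apply: eq_Rintegral => y _; rewrite cexpNi /phased_integrand.
  by case: (char_fun mu y) => p q /=; rewrite subr0; ring.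
case: (char_fun mu y) => p q /=.
by rewrite opprK cosD sinD cos_pihalf sin_pihalf; ring.
Qed.
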